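(* Let $c>0$ and $T>0$. For $t\in[0,T]$ and a function $h(\xi)$ on $\mathbb{R}^2$ define \[ \|h\|_{t}:=\left\|\frac{(1+|\xi|)^3 h(\xi)}{e^{-c|\xi|t}+e^{-c|\xi|(T-t)}}\right\|_{L^\infty(\mathbb{R}^2_\xi)}, \] and for $\hat f(\xi,s)$ defined for $s\in[0,T]$ set $\|\hat f\|:=\sup_{s\in[0,T]}\|\hat f(\cdot,s)\|_s$. There exists $K>0$ (independent of $T$) such that for any $\hat f$ with $\|\hat f\|<+\infty$ and all $t\in[0,T]$, \[ \left\|\int_0^t e^{-2c|\xi|(t-s)}|\xi|\,\hat f(\xi,s)\,ds\right\|_t\leqslant K\|\hat f\|. \]
   Context: $\xi\in\mathbb{R}^2$ is the Fourier variable. *)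

(* Defs.v *)
From HB Require Import structures.
From mathcomp Require Import all_boot all_order all_algebra.
From mathcomp Require Import all_classical all_reals all_analysis.
From mathcomp Require Import complex ess_sup_inf.
Set Implicit Arguments. Unset Strict Implicit. Unset Printing Implicit Defensive.
Import Order.TTheory GRing.Theory Num.Theory.
Import numFieldNormedType.Exports.
Local Open Scope classical_set_scope.
Local Open Scope ring_scope.

Definition leb2 (R : realType) := (@lebesgue_measure R \x @lebesgue_measure R)%E.

Definition xnorm (R : realType) (xi : R * R) : R := Num.sqrt (xi.1 ^+ 2 + xi.2 ^+ 2).

Definition cmod (R : realType) (z : R[i]) : R :=
  Num.sqrt (complex.Re z ^+ 2 + complex.Im z ^+ 2).

Definition cintegral (R : realType) (D : set R) (g : R -> R[i]) : R[i] :=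
  Complex (Rintegral (@lebesgue_measure R) D (fun s => complex.Re (g s)))
          (Rintegral (@lebesgue_measure R) D (fun s => complex.Im (g s))).

Definition wnorm (R : realType) (c T t : R) (h : R * R -> R[i]) : \bar R :=
  ess_sup (@leb2 R) (fun xi =>
    ((1 + xnorm xi) ^+ 3 * cmod (h xi)
      / (expR (- c * xnorm xi * t) + expR (- c * xnorm xi * (T - t))))%:E).

Definition fnorm (R : realType) (c T : R) (f : R * R -> R -> R[i]) : \bar R :=
  ereal_sup [set wnorm c T s (fun xi => f xi s) | s in `[0, T]].

(* Main.v *)
(* Fix xi, put r = |xi| and w_s = e^{-crs} + e^{-cr(T-s)}.  For 0 <= s <= t,
   w_s e^{-2cr(t-s)} <= w_t e^{-cr(t-s)}, and r e^{-cr(t-s)} integrates over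
   [0, t] to at most 1/c.  Hence if |f(xi, s)| <= m w_s / (1 + r)^3 for almost
   every s in [0, t], the integral at xi has modulus at most 2 m w_t / (c (1 + r)^3),
   the factor 2 coming from |z| <= |Re z| + |Im z|; this gives K = 2/c.
   The hypothesis ||f|| = m only provides, for each s, that bound for almost
   every xi; Tonelli's theorem applied to the measurable set of pairs (xi, s)
   where it fails exchanges the two quantifiers. *)
Require Import Defs.
From HB Require Import structures.
From mathcomp Require Import all_boot all_order all_algebra.
From mathcomp Require Import all_classical all_reals all_analysis.
From mathcomp Require Import complex ess_sup_inf.
From mathcomp Require Import measurable_realfun ring.
Import Order.TTheory GRing.Theory Num.Theory.
Import numFieldNormedType.Exports.
Local Open Scope classical_set_scope.
Local Open Scope ring_scope.

(* Typeclass inference does not find the a.e. filter of [lebesgue_measure] or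
   [leb2], so [filterS] is specialised by hand. *)
Lemma ae_filterS {d} {T : ringOfSetsType d} {R : realFieldType}
    (mu : {measure set T -> \bar R}) (P Q : T -> Prop) :
  (forall x, P x -> Q x) -> {ae mu, forall x, P x} -> {ae mu, forall x, Q x}.
Proof. exact: (@filterS _ _ (ae_filter_ringOfSetsType mu)). Qed.

Lemma normr_Rintegral_le {d} {T : measurableType d} {R : realType}
    {mu : {measure set T -> \bar R}} {D : set T} {u : T -> R} (g : T -> R) {B : R} :
  measurable D -> measurable_fun D u -> measurable_fun D g ->
  (forall x, D x -> 0 <= g x) ->
  {ae mu, forall x, D x -> `|u x| <= g x} ->
  (\int[mu]_(x in D) (g x)%:E <= B%:E)%E ->
  `|Rintegral mu D u| <= B.
Proof.
move=> mD mu_ mg g_ge0 u_le ig_le.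
have iu_le : (\int[mu]_(x in D) (`|u x|)%:E <= B%:E)%E.
  apply: le_trans ig_le; apply: ae_ge0_le_integral => //.
  - by apply/measurable_EFinP; exact: measurableT_comp.
  - exact/measurable_EFinP.
have iu : mu.-integrable D (EFin \o u).
  apply/integrableP; split; first exact/measurable_EFinP.
  by apply: le_lt_trans iu_le _; rewrite ltey.
apply: le_trans (le_normr_Rintegral mD iu) _.
rewrite -[leRHS]/(fine B%:E); apply: fine_le => //.
rewrite ge0_fin_numE; first by apply: le_lt_trans iu_le _; rewrite ltey.
by apply: integral_ge0 => x _; rewrite lee_fin.
Qed.

(* The library's sigma-finite instance for [\x] is local to a section. *)
Lemma product_measure1_sigma_finite {d1 d2} {T1 : measurableType d1}
    {T2 : measurableType d2} {R : realType}
    (m1 : {sigma_finite_measure set T1 -> \bar R})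
    (m2 : {sigma_finite_measure set T2 -> \bar R}) :
  sigma_finite setT (m1 \x m2)%E.
Proof.
have /sigma_finiteP[F [TF ndF Foo]] := sigma_finiteT m1.
have /sigma_finiteP[G [TG ndG Goo]] := sigma_finiteT m2.
exists (fun n => F n `*` G n).
  rewrite -setXTT TF TG predeqE => -[x y]; split.
    move=> [/= [n _ Fnx] [k _ Gky]]; exists (maxn n k) => //; split.
    - by move: x Fnx; exact/subsetPset/ndF/leq_maxl.
    - by move: y Gky; exact/subsetPset/ndG/leq_maxr.
  by move=> [n _ []/= ? ?]; split; exists n.
move=> k; have [? ?] := Foo k; have [? ?] := Goo k.
split; first exact: measurableX.
by rewrite product_measure1E// lte_mul_pinfty// ge0_fin_numE.
Qed.

HB.instance Definition _ (R : realType) := Measure.on (@leb2 R).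
HB.instance Definition _ (R : realType) := Measure_isSigmaFinite.Build _ _ _
  (@leb2 R) (product_measure1_sigma_finite _ _).

Section tonelli_null_sections.
Local Open Scope ereal_scope.
Context {d1 d2} {T1 : measurableType d1} {T2 : measurableType d2} {R : realType}.
Variables (m1 : {sigma_finite_measure set T1 -> \bar R})
          (m2 : {sigma_finite_measure set T2 -> \bar R}).

Lemma ae_xsection_null {E : set (T1 * T2)} : measurable E ->
  (forall y, m1 (ysection E y) = 0) -> {ae m1, forall x, m2 (xsection E x) = 0}.
Proof.
move=> mE ysec0.
have xsec0 : \int[m1]_x (m2 \o xsection E) x = 0.
  have := indic_fubini_tonelli m1 m2 mE.
  rewrite indic_fubini_tonelli_FE // indic_fubini_tonelli_GE // => ->.
  by apply: integral0_eq => y _; exact: ysec0.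
have mxsec := measurable_fun_xsection m2 mE.
have /(ae_eq_integral_abs m1 measurableT mxsec).1 :
    \int[m1]_x `|(m2 \o xsection E) x| = 0.
  by rewrite -xsec0; apply: eq_integral => x _; rewrite gee0_abs.
by apply: ae_filterS => x /(_ I).
Qed.

Lemma ae_swap_le {B : set T2} {g h : T1 * T2 -> R} : measurable B ->
  measurable_fun (setT `*` B) g -> measurable_fun (setT `*` B) h ->
  (forall y, B y -> {ae m1, forall x, g (x, y) <= h (x, y)}%R) ->
  {ae m1, forall x, {ae m2, forall y, B y -> g (x, y) <= h (x, y)}%R}.
Proof.
move=> mB mg mh gh.
pose E := (setT `*` B) `&` (fun p => h p < g p)%R @^-1` [set true].
have mE : measurable E by apply: measurable_fun_ltr => //; exact: measurableX.
have ysec0 y : m1 (ysection E y) = 0.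
  have [By|nBy] := pselect (B y).
    have [N [mN N0 gN]] := gh y By.
    apply/eqP; rewrite eq_le measure_ge0 andbT -N0 le_measure ?inE //.
      exact: measurable_ysection.
    move=> x; rewrite /ysection /= inE => -[_ hg]; apply: gN => /=.
    by rewrite leNgt hg.
  rewrite (_ : ysection E y = set0) ?measure0 //; apply/seteqP; split => // x.
  by rewrite /ysection /= inE => -[[_ /= By] _].
apply: ae_filterS (ae_xsection_null mE ysec0) => x xsec0.
exists (xsection E x); split => //; first exact: measurable_xsection.
move=> y /= /not_implyP[By /negP]; rewrite -ltNge => hg.
by rewrite /xsection /= inE.
Qed.

End tonelli_null_sections.

Lemma measurable_fun_pair2_setX {d1 d2 d3} {T1 : measurableType d1}
    {T2 : measurableType d2} {T3 : measurableType d3}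
    {B : set T2} {g : T1 * T2 -> T3} (x : T1) :
  measurable B -> measurable_fun (setT `*` B) g -> measurable_fun B (fun y => g (x, y)).
Proof.
move=> mB mg; apply: (measurable_comp _ _ mg) => //.
- exact: measurableX.
- by move=> _ [y By <-].
- exact: measurable_funS (pair1_measurable x).
Qed.

Section complex_modulus.
Context {R : realType}.
Implicit Types (x : R) (z : R[i]).

Lemma Re_realM x z : complex.Re (x%:C%C * z) = x * complex.Re z.
Proof. by case: z => a b /=; rewrite mul0r subr0. Qed.

Lemma Im_realM x z : complex.Im (x%:C%C * z) = x * complex.Im z.
Proof. by case: z => a b /=; rewrite mul0r addr0. Qed.

Lemma normr_Re_le_cmod z : `|complex.Re z| <= cmod z.
Proof. by rewrite /cmod -sqrtr_sqr ler_wsqrtr // lerDl sqr_ge0. Qed.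

Lemma normr_Im_le_cmod z : `|complex.Im z| <= cmod z.
Proof. by rewrite /cmod -sqrtr_sqr ler_wsqrtr // lerDr sqr_ge0. Qed.

Lemma cmod_le_normD (a b : R) : cmod (Complex a b) <= `|a| + `|b|.
Proof.
rewrite /cmod /= -[leRHS]ger0_norm ?addr_ge0 // -sqrtr_sqr ler_wsqrtr //.
by rewrite sqrrD !real_normK ?num_real // -addrA lerD2l lerDr mulrn_wge0 ?mulr_ge0.
Qed.

Lemma measurable_fun_cmod d (T : measurableType d) (D : set T) (F : T -> R[i]) :
  measurable_fun D (fun p => complex.Re (F p)) ->
  measurable_fun D (fun p => complex.Im (F p)) ->
  measurable_fun D (fun p => cmod (F p)).
Proof.
move=> mRe mIm; apply: measurableT_comp.
  exact: continuous_measurable_fun (@sqrt_continuous R).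
by apply: measurable_funD; apply: measurable_funX.
Qed.

End complex_modulus.

Section exponential_kernel.
Context {R : realType}.

Lemma integral_exp_kernel (c r t : R) : 0 < c -> 0 < t ->
  (\int[lebesgue_measure]_(s in `[0%R, t]) (r * expR (c * r * (s - t)))%:E
   = ((1 - expR (- (c * r * t))) / c)%:E)%E.
Proof.
move=> c_gt0 t_gt0; pose F s := expR (c * r * (s - t)) / c.
have dF (x : R) : is_derive x 1 F (r * expR (c * r * (x - t))).
  by apply: is_derive_eq; rewrite /GRing.scale /=; field; exact: lt0r_neq0.
have cF : continuous F.
  by move=> x; apply/differentiable_continuous/derivable1_diffP; case: (dF x).
have ck : continuous (fun s => r * expR (c * r * (s - t))).
  by move=> x; apply/differentiable_continuous/derivable1_diffP; apply: ex_derive.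
rewrite (@continuous_FTC2 _ _ F) //.
- by rewrite /F subrr mulr0 expR0 sub0r mulrN -EFinB mulrBl.
- exact: continuous_subspaceT ck.
- split; first by move=> x _; case: (dF x).
  + exact/cvg_at_right_filter/cF.
  + exact/cvg_at_left_filter/cF.
- by move=> x _; rewrite derive1E derive_val.
Qed.

Lemma integral_exp_kernel_le (c r t : R) : 0 < c -> 0 <= r -> 0 <= t ->
  (\int[lebesgue_measure]_(s in `[0%R, t]) (r * expR (c * r * (s - t)))%:E
   <= (c^-1)%:E)%E.
Proof.
move=> c_gt0 r_ge0; rewrite le_eqVlt => /predU1P[<-|t_gt0].
  by rewrite set_itv1 integral_set1 lee_fin invr_ge0 ltW.
by rewrite integral_exp_kernel // lee_fin -[leRHS]mul1r ler_pM2r ?invr_gt0.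
Qed.

End exponential_kernel.

Section kernel_estimate.
Context {R : realType}.
Variables (c T r : R).
Hypotheses (c_gt0 : 0 < c) (r_ge0 : 0 <= r).

Definition boundary_weight (s : R) := expR (- c * r * s) + expR (- c * r * (T - s)).

Lemma boundary_weight_gt0 s : 0 < boundary_weight s.
Proof. by rewrite addr_gt0 ?expR_gt0. Qed.

Lemma boundary_weight_kernel_le s t : s <= t ->
  boundary_weight s * expR (- (2 * c) * r * (t - s))
  <= boundary_weight t * expR (c * r * (s - t)).
Proof.
move=> st; rewrite /boundary_weight [leLHS]mulrDl [leRHS]mulrDl -!expRD.
have -> : - c * r * s + - (2 * c) * r * (t - s) = - c * r * t + c * r * (s - t).
  by ring.
rewrite lerD2l ler_expR -subr_ge0 (_ : _ - _ = 2 * c * r * (t - s)); last by ring.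
by rewrite !mulr_ge0 ?subr_ge0 // ltW.
Qed.

Lemma kernel_mul_le (s t C x : R) : s <= t -> 0 <= C ->
  `|x| <= C * boundary_weight s ->
  `|expR (- (2 * c) * r * (t - s)) * r * x|
  <= C * boundary_weight t * (r * expR (c * r * (s - t))).
Proof.
move=> st C_ge0 x_le; rewrite normrM ger0_norm ?mulr_ge0 ?expR_ge0 //.
apply: le_trans (ler_wpM2l (mulr_ge0 (expR_ge0 _) r_ge0) x_le) _.
have -> : expR (- (2 * c) * r * (t - s)) * r * (C * boundary_weight s)
          = C * r * (boundary_weight s * expR (- (2 * c) * r * (t - s))) by ring.
have -> : C * boundary_weight t * (r * expR (c * r * (s - t)))
          = C * r * (boundary_weight t * expR (c * r * (s - t))) by ring.
by rewrite ler_wpM2l ?mulr_ge0 // boundary_weight_kernel_le.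
Qed.

Lemma Rintegral_kernel_le (t C : R) (v : R -> R) : 0 <= t -> 0 <= C ->
  measurable_fun `[0, t] v ->
  {ae lebesgue_measure, forall s, s \in `[0, t] -> `|v s| <= C * boundary_weight s} ->
  `|Rintegral lebesgue_measure `[0, t]
      (fun s => expR (- (2 * c) * r * (t - s)) * r * v s)|
  <= C * boundary_weight t / c.
Proof.
move=> t_ge0 C_ge0 mv v_le.
have Cw_ge0 : 0 <= C * boundary_weight t by rewrite mulr_ge0 // ltW ?boundary_weight_gt0.
pose g s := C * boundary_weight t * (r * expR (c * r * (s - t))).
have mdom : measurable_fun `[0, t] (fun s => r * expR (c * r * (s - t))).
  apply: measurable_funM => //; apply: measurableT_comp => //.
  by apply: measurable_funM => //; apply: measurable_funB.
have mintegrand : measurable_fun `[0, t] (fun s => expR (- (2 * c) * r * (t - s)) * r * v s).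
  apply: measurable_funM => //; apply: measurable_funM => //.
  apply: measurableT_comp => //.
  by apply: measurable_funM => //; apply: measurable_funB.
have mg : measurable_fun `[0, t] g by apply: measurable_funM.
apply: (normr_Rintegral_le (mu := lebesgue_measure) g).
- exact: measurable_itv.
- exact: mintegrand.
- exact: mg.
- by move=> s _; rewrite mulr_ge0 // mulr_ge0 ?expR_ge0.
- apply: ae_filterS v_le => s v_les /[dup] s_in /v_les.
  move: s_in; rewrite /= in_itv /= => /andP[_ st].
  exact: kernel_mul_le.
- under eq_integral do rewrite EFinM.
  rewrite ge0_integralZl_EFin //; last 2 first.
  + by move=> s _; rewrite lee_fin mulr_ge0 ?expR_ge0.
  + exact/measurable_EFinP.
  rewrite -[X in (_ <= X)%E]/((C * boundary_weight t) * c^-1)%:E.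
  rewrite [X in (_ <= X)%E]EFinM.
  by apply: lee_wpmul2l; rewrite ?lee_fin // integral_exp_kernel_le.
Qed.

Lemma cmod_cintegral_kernel_le (t C : R) (u : R -> R[i]) : 0 <= t -> 0 <= C ->
  measurable_fun `[0, t] (fun s => complex.Re (u s)) ->
  measurable_fun `[0, t] (fun s => complex.Im (u s)) ->
  {ae lebesgue_measure, forall s, s \in `[0, t] -> cmod (u s) <= C * boundary_weight s} ->
  cmod (cintegral `[0, t]
      (fun s => (expR (- (2 * c) * r * (t - s)) * r)%:C%C * u s))
  <= 2 * C * boundary_weight t / c.
Proof.
move=> t_ge0 C_ge0 mRe mIm u_le; rewrite /cintegral.
under [X in Complex (Rintegral _ _ X) _]eq_fun do rewrite Re_realM.
under [X in Complex _ (Rintegral _ _ X)]eq_fun do rewrite Im_realM.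
apply: le_trans (cmod_le_normD _ _) _.
rewrite (_ : 2 * C * _ / c = C * boundary_weight t / c + C * boundary_weight t / c).
  apply: lerD; apply: Rintegral_kernel_le => //.
  - by apply: ae_filterS u_le => s u_les /u_les; apply: le_trans (normr_Re_le_cmod _).
  - by apply: ae_filterS u_le => s u_les /u_les; apply: le_trans (normr_Im_le_cmod _).
by ring.
Qed.

End kernel_estimate.

Lemma leb2_setT_gt0 {R : realType} : (0 < (@leb2 R) [set: R * R])%E.
Proof.
apply: (@lt_le_trans _ _ ((@leb2 R) (`[0%R, 1%R] `*` `[0%R, 1%R]))).
  rewrite /leb2 product_measure1E //= lebesgue_measure_itv /=.
  by rewrite lte_fin ltr01 oppr0 adde0 mule1 lte_fin ltr01.
by apply: le_measure; rewrite ?inE //; exact: measurableX.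
Qed.

Lemma measurable_xnorm {R : realType} : measurable_fun setT (@xnorm R).
Proof.
apply: measurableT_comp; first exact: continuous_measurable_fun (@sqrt_continuous R).
by apply: measurable_funD; apply: measurable_funX; [exact: measurable_fst | exact: measurable_snd].
Qed.

Section weighted_norms.
Context {R : realType}.
Variables (c T : R).

Lemma wnorm_ge0 (t : R) (h : R * R -> R[i]) : (0 <= wnorm c T t h)%E.
Proof.
apply: ess_sup_ger leb2_setT_gt0 _ => xi.
by rewrite lee_fin divr_ge0 ?mulr_ge0 ?exprn_ge0 ?addr_ge0 ?sqrtr_ge0 ?expR_ge0.
Qed.

Lemma fnorm_ge0 (f : R * R -> R -> R[i]) : 0 <= T -> (0 <= fnorm c T f)%E.
Proof.
move=> T_ge0; apply: le_trans (wnorm_ge0 0 (fun xi => f xi 0)) _.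
by apply: ereal_sup_ubound; exists 0 => //; rewrite /= in_itv /= lexx.
Qed.

Lemma wnorm_le_ae (t m : R) (h : R * R -> R[i]) : (wnorm c T t h <= m%:E)%E ->
  {ae @leb2 R, forall xi,
    (1 + xnorm xi) ^+ 3 * cmod (h xi) <= m * boundary_weight c T (xnorm xi) t}.
Proof.
move/ess_supP; apply: ae_filterS => xi.
by rewrite lee_fin ler_pdivrMr ?boundary_weight_gt0.
Qed.

Lemma fnorm_ae_le {f : R * R -> R -> R[i]} {m : R} :
  measurable_fun ([set: R * R] `*` `[0, T]) (fun p => complex.Re (f p.1 p.2)) ->
  measurable_fun ([set: R * R] `*` `[0, T]) (fun p => complex.Im (f p.1 p.2)) ->
  fnorm c T f = m%:E ->
  {ae @leb2 R, forall xi, {ae lebesgue_measure, forall s, s \in `[0, T] ->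
    (1 + xnorm xi) ^+ 3 * cmod (f xi s) <= m * boundary_weight c T (xnorm xi) s}}.
Proof.
move=> mRe mIm fnormE.
have mxnorm1 : measurable_fun setT (fun p : (R * R) * R => xnorm p.1).
  exact: measurableT_comp measurable_xnorm measurable_fst.
have mweighted : measurable_fun ([set: R * R] `*` `[0, T])
    (fun p => (1 + xnorm p.1) ^+ 3 * cmod (f p.1 p.2)).
  apply: measurable_funM; last exact: measurable_fun_cmod.
  by apply: measurable_funX; apply: measurable_funD => //; exact: measurable_funS mxnorm1.
have mbound : measurable_fun ([set: R * R] `*` `[0, T])
    (fun p => m * boundary_weight c T (xnorm p.1) p.2).
  apply: measurable_funS (_ : measurable_fun setT _) => //.
  apply: measurable_funM => //; apply: measurable_funD; apply: measurableT_comp => //.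
    by apply: measurable_funM => //; apply: measurable_funM.
  by apply: measurable_funM; [apply: measurable_funM | apply: measurable_funB].
apply: (ae_swap_le (@leb2 R) lebesgue_measure (measurable_itv _) mweighted mbound) => s s_in.
by apply: wnorm_le_ae; rewrite -fnormE; apply: ereal_sup_ubound; exists s.
Qed.

End weighted_norms.

Theorem lemma8 (R : realType) (c : R) (hc : 0 < c) :
  exists K : R, 0 < K /\
  forall (T : R), 0 < T ->
  forall f : R * R -> R -> R[i],
    measurable_fun ([set: R * R] `*` `[0, T]) (fun p => complex.Re (f p.1 p.2)) ->
    measurable_fun ([set: R * R] `*` `[0, T]) (fun p => complex.Im (f p.1 p.2)) ->
    (fnorm c T f < +oo)%E ->
    forall t : R, t \in `[(0:R), T] ->
      (wnorm c T t (fun xi =>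
         cintegral `[(0:R), t] (fun s =>
           (expR (- (2 * c) * xnorm xi * (t - s)) * xnorm xi)%:C%C * f xi s))%R
       <= K%:E * fnorm c T f)%E.
Proof.
exists (2 / c); split; first by rewrite divr_gt0.
move=> T T_gt0 f mRe mIm f_fin t t_in.
have [m m_ge0 fnormE] : exists2 m, 0 <= m & fnorm c T f = m%:E.
  have f_ge0 := fnorm_ge0 c T f (ltW T_gt0).
  by exists (fine (fnorm c T f)); rewrite ?fine_ge0 ?fineK ?ge0_fin_numE.
move: t_in; rewrite in_itv /= => /andP[t_ge0 t_le_T].
rewrite fnormE -EFinM; apply/ess_supP.
apply: ae_filterS (fnorm_ae_le c T mRe mIm fnormE) => xi f_xi_le.
set r := xnorm xi; have r_ge0 : 0 <= r := sqrtr_ge0 _.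
have r3_gt0 : 0 < (1 + r) ^+ 3 by rewrite exprn_gt0 // ltr_pwDl.
have C_ge0 : 0 <= m / (1 + r) ^+ 3 by rewrite divr_ge0 // ltW.
rewrite lee_fin ler_pdivrMr ?boundary_weight_gt0 //.
apply: le_trans (ler_wpM2l (ltW r3_gt0)
  (@cmod_cintegral_kernel_le _ c T r hc r_ge0 t _ (f xi) t_ge0 C_ge0 _ _ _)) _.
- apply: measurable_funS (measurable_fun_pair2_setX xi (measurable_itv _) mRe) => //.
  exact: subset_itvl.
- apply: measurable_funS (measurable_fun_pair2_setX xi (measurable_itv _) mIm) => //.
  exact: subset_itvl.
- apply: ae_filterS f_xi_le => s f_xis_le s_in.
  rewrite mulrAC ler_pdivlMr // mulrC; apply: f_xis_le.
  by move: s_in; rewrite /= !in_itv /= => /andP[-> /le_trans ->].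
- rewrite -/(boundary_weight c T r t) le_eqVlt; apply/orP; left; apply/eqP.
  by field; rewrite !lt0r_neq0 // ltr_pwDl.
Qed.
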